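(* Let $K$ be a non-compact locally compact hypergroup with a left Haar measure and let $\sigma$ be a non-degenerate probability measure on $K$. Then $H_\sigma(K)=\{0\}$.
   Context: $K$ is a locally compact hypergroup (Jewett/Bloom–Heyer sense), assumed to have a left Haar measure, with measure algebra $(M(K),* )$. For $\sigma\in M(K)$, $H_\sigma(K)=\{\mu\in M(K):\sigma*\mu=\mu\}$. For subsets $A,B\subseteq K$, $A*B=\bigcup_{a\in A,b\in B}\operatorname{supp}(\delta_a*\delta_b)$ and $A^n$ is the $n$-fold product. A measure $\mu\in M(K)$ is non-degenerate if $K=\overline{\bigcup_{n\geq1}(\operatorname{supp}|\mu|)^n}$. *)

(* Defs.v *)
From HB Require Import structures.
From mathcomp Require Import all_boot all_order all_algebra.
From mathcomp Require Import all_classical all_reals all_analysis.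
Set Implicit Arguments. Unset Strict Implicit. Unset Printing Implicit Defensive.
Import Order.TTheory GRing.Theory Num.Theory.
Import numFieldNormedType.Exports.
Local Open Scope classical_set_scope.
Local Open Scope ring_scope.

Section Hypergroup.
Variables (R : realType) (K : ptopologicalType).

Definition Bor : Type := g_sigma_algebraType (@open K).

Definition pmeas := {measure set Bor -> \bar R}.

Definition msupport (mu : pmeas) : set K :=
  [set x | forall U : set K, open U -> U x -> (0 < mu U)%E].

Definition radon (mu : pmeas) : Prop :=
  [/\ (forall C : set K, compact C -> (mu C < +oo)%E),
      (forall A : set Bor, measurable A ->
          mu A = ereal_inf [set mu U | U in [set U : set K | open U /\ A `<=` U]]) &
      (forall U : set K, open U ->
          mu U = ereal_sup [set mu C | C in [set C : set K | compact C /\ C `<=` U]])].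

Definition finite_meas (mu : pmeas) : Prop := (mu setT < +oo)%E.

Definition Cc (f : K -> R) : Prop :=
  continuous f /\ exists C : set K, compact C /\ forall x, ~ C x -> f x = 0.
Definition Cb (f : K -> R) : Prop :=
  continuous f /\ exists M : R, forall x, `|f x| <= M.

(* Jewett / Bloom-Heyer hypergroup axioms for the data
   conv x y = delta_x * delta_y, identity e, involution inv. *)
Record is_hypergroup (conv : K -> K -> pmeas) (e : K) (inv : K -> K) : Prop := {
  hg_lc : locally_compact [set: K];
  hg_hausdorff : hausdorff_space K;
  hg_prob : forall x y, conv x y setT = 1%E;
  hg_radon : forall x y, radon (conv x y);
  hg_cpt_supp : forall x y, compact (msupport (conv x y));
  hg_assoc : forall x y z (A : set Bor), measurable A ->
    (\int[conv x y]_u conv u z A = \int[conv y z]_v conv x v A)%E;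
  hg_weak_cont : forall f : K -> R, Cb f ->
    continuous (fun p : K * K => fine (\int[conv p.1 p.2]_u (f u)%:E)%E);
  (* continuity of (x,y) |-> supp(d_x * d_y) for the Michael topology *)
  hg_michael1 : forall U : set K, open U ->
    open [set p : K * K | msupport (conv p.1 p.2) `&` U !=set0];
  hg_michael2 : forall V : set K, open V ->
    open [set p : K * K | msupport (conv p.1 p.2) `<=` V];
  hg_unit : forall x (A : set Bor), measurable A ->
    conv e x A = \d_(x : Bor) A /\ conv x e A = \d_(x : Bor) A;
  hg_inv_cont : continuous inv;
  hg_invK : forall x, inv (inv x) = x;
  hg_inv_conv : forall x y (A : set Bor), measurable A ->
    conv x y (inv @^-1` A) = conv (inv y) (inv x) A;
  hg_e_supp : forall x y, msupport (conv x y) e <-> y = inv x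
}.

Definition has_left_Haar (conv : K -> K -> pmeas) : Prop :=
  exists m : pmeas, [/\ radon m,
    (exists A : set Bor, measurable A /\ (0 < m A)%E) &
    forall x (f : K -> R), Cc f ->
      (\int[m]_y \int[conv x y]_u (f u)%:E = \int[m]_y (f y)%:E)%E].

(* A * B and A^n (A^0 here denotes A^1) *)
Definition setconv (conv : K -> K -> pmeas) (A B : set K) : set K :=
  [set z | exists a b, [/\ A a, B b & msupport (conv a b) z]].
Fixpoint setpow (conv : K -> K -> pmeas) (A : set K) (n : nat) : set K :=
  if n is n'.+1 then setconv conv (setpow conv A n') A else A.

Definition hg_nondegenerate (conv : K -> K -> pmeas) (sigma : pmeas) : Prop :=
  closure (\bigcup_(n in [set: nat]) setpow conv (msupport sigma) n) = [set: K].

(* M(K): bounded complex Radon measures, represented by their Jordan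
   decompositions mu = (mu_rp - mu_rn) + i (mu_ip - mu_in). *)
Record cmeasure := CMeasure {
  mu_rp : pmeas; mu_rn : pmeas; mu_ip : pmeas; mu_in : pmeas;
  cm_finite : [/\ finite_meas mu_rp, finite_meas mu_rn,
                  finite_meas mu_ip & finite_meas mu_in];
  cm_radon : [/\ radon mu_rp, radon mu_rn, radon mu_ip & radon mu_in] }.

Definition cval (mu : cmeasure) (A : set Bor) : R * R :=
  (fine (mu_rp mu A) - fine (mu_rn mu A), fine (mu_ip mu A) - fine (mu_in mu A)).

Definition cconv (conv : K -> K -> pmeas) (sigma : pmeas) (mu : cmeasure)
    (A : set Bor) : R * R :=
  let g := fun y : Bor => (\int[sigma]_x conv x y A)%E in
  (fine (\int[mu_rp mu]_y g y)%E - fine (\int[mu_rn mu]_y g y)%E,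
   fine (\int[mu_ip mu]_y g y)%E - fine (\int[mu_in mu]_y g y)%E).

Definition H_sigma (conv : K -> K -> pmeas) (sigma : pmeas) : set cmeasure :=
  [set mu | forall A : set Bor, measurable A -> cconv conv sigma mu A = cval mu A].

Definition zero_cmeasure (mu : cmeasure) : Prop :=
  forall A : set Bor, measurable A -> cval mu A = (0, 0).

End Hypergroup.

(* Main.v *)
Require Import Defs.
From HB Require Import structures.
From mathcomp Require Import all_boot all_order all_algebra.
From mathcomp Require Import all_classical all_reals all_analysis.
From mathcomp Require Import measurable_realfun lra.
Set Implicit Arguments.
Unset Strict Implicit.
Unset Printing Implicit Defensive.
Import Order.TTheory GRing.Theory Num.Theory.
Import numFieldNormedType.Exports.
Local Open Scope classical_set_scope.
Local Open Scope ring_scope.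

(** Let [P - N] be the real or the imaginary part of a measure fixed by
[sigma * _], and for [f] in [Cc] put [h x = \int f(x * y) d(P - N)(y)].
Invariance of [P - N], applied to the left translates of [f], gives
[h a = \int h(a * x) dsigma(x)]. Moreover [h] is continuous and, since
[z \in x * y] forces [x \in z * y^-], it vanishes at infinity. If [h] were
positive somewhere it would attain its maximum at some [a]. The translate
[x |-> h(a * x)] is again harmonic and is maximal at [e], so by
non-degeneracy it is constant; as [e \in a * a^-], also [h e] is the maximum,
and then [h] is constant, which is absurd on a non-compact space. Exchanging
[P] and [N] gives [h = 0], so [P] and [N] integrate every [f] in [Cc] equally
and agree by regularity.

[K] need not be second countable: a continuous function on [K * K] is in
general not measurable for the product of the Borel sigma-algebras, and
[conv x y A] is not known to be measurable in [x] or [y]. *)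

(** * Integrals of bounded Borel functions *)

Section Expectation.
Context {R : realType} {K : ptopologicalType}.
Implicit Types (m : pmeas R K) (f g : K -> R).

(** Convertible to [Rintegral], so that its linearity lemmas apply. Since [fine] sends infinities to
    0, the value is faithful only for a finite integral, which [expectK] guarantees for [bmeas]
    functions and finite measures. *)
Definition expect m f : R := fine (\int[m]_x (f x)%:E)%E.

Definition bmeas f :=
  measurable_fun [set: Bor K] (f : Bor K -> R) /\ exists M : R, forall x, `|f x| <= M.

Lemma open_Bor (U : set K) : open U -> measurable (U : set (Bor K)).
Proof. by move=> oU; apply: sub_sigma_algebra. Qed.

Lemma closed_Bor (C : set K) : closed C -> measurable (C : set (Bor K)).
Proof.
move=> cC; rewrite -[C]setCK; apply: measurableC; apply: open_Bor.
exact: closed_openC.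
Qed.

Lemma continuous_Bor f : continuous f ->
  measurable_fun [set: Bor K] (f : Bor K -> R).
Proof.
move=> cf; apply: (measurability _ (RGenOInfty.measurableE R)).
move=> _ [_ [x ->] <-]; rewrite setTI.
apply: open_Bor; apply: open_comp; last exact: interval_open.
by move=> y _; exact: cf.
Qed.

Lemma Cb_bmeas f : Cb f -> bmeas f.
Proof. by move=> [cf bf]; split => //; exact: continuous_Bor. Qed.

Lemma bmeas_cst (c : R) : bmeas (fun=> c).
Proof. by split; [exact: measurable_cst | exists `|c|]. Qed.

Lemma bmeasD f g : bmeas f -> bmeas g -> bmeas (fun x => f x + g x).
Proof.
move=> [mf [M hM]] [mg [N hN]]; split; first exact: measurable_funD.
by exists (M + N) => x; rewrite (le_trans (ler_normD _ _))// lerD.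
Qed.

Lemma bmeasM f g : bmeas f -> bmeas g -> bmeas (fun x => f x * g x).
Proof.
move=> [mf [M hM]] [mg [N hN]]; split; first exact: measurable_funM.
by exists (M * N) => x; rewrite normrM ler_pM.
Qed.

Lemma bmeasZ (c : R) f : bmeas f -> bmeas (fun x => c * f x).
Proof. exact/bmeasM/bmeas_cst. Qed.

Lemma bmeasN f : bmeas f -> bmeas (fun x => - f x).
Proof.
by move=> bf; rewrite (_ : (fun x => - f x) = (fun x => -1 * f x));
  [exact: bmeasZ | apply/funext => x; rewrite mulN1r].
Qed.

Lemma bmeasB f g : bmeas f -> bmeas g -> bmeas (fun x => f x - g x).
Proof. by move=> bf bg; apply: bmeasD => //; exact: bmeasN. Qed.

Lemma bmeas_indic (A : set K) : measurable (A : set (Bor K)) ->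
  bmeas (\1_A : K -> R).
Proof.
move=> mA; split; first exact: (measurable_indic (T := Bor K)).
by exists 1 => x; rewrite indicE; case: (_ \in _); rewrite ?normr1 ?normr0.
Qed.

Lemma bmeas_integrable m f : finite_meas m -> bmeas f ->
  m.-integrable setT (EFin \o f : Bor K -> \bar R).
Proof.
move=> fm [mf [M hM]]; apply: measurable_bounded_integrable => //.
exists M; split; first exact: num_real.
by move=> y My x _; apply: le_trans (hM x) (ltW My).
Qed.

Section finite.
Variable m : pmeas R K.
Hypothesis fm : finite_meas m.

Lemma expectK f : bmeas f -> (expect m f)%:E = (\int[m]_x (f x)%:E)%E.
Proof.
move=> bf; rewrite /expect fineK//.
by apply: integrable_fin_num => //; exact: bmeas_integrable.
Qed.

Lemma expectD f g : bmeas f -> bmeas g ->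
  expect m (fun x => f x + g x) = expect m f + expect m g.
Proof. by move=> bf bg; apply: RintegralD => //; exact: bmeas_integrable. Qed.

Lemma expectZ (c : R) f : bmeas f -> expect m (fun x => c * f x) = c * expect m f.
Proof. by move=> bf; apply: RintegralZl => //; exact: bmeas_integrable. Qed.

Lemma expectB f g : bmeas f -> bmeas g ->
  expect m (fun x => f x - g x) = expect m f - expect m g.
Proof. by move=> bf bg; apply: RintegralB => //; exact: bmeas_integrable. Qed.

Lemma expect_cst (c : R) : expect m (fun=> c) = c * fine (m setT).
Proof. exact: (Rintegral_cst m measurableT c). Qed.

Lemma expect_indic (A : set K) : measurable (A : set (Bor K)) ->
  expect m \1_A = fine (m A).
Proof. by move=> mA; rewrite /expect integral_indic// setIT. Qed.

Lemma expect_le f g : bmeas f -> bmeas g -> (forall x, f x <= g x) ->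
  expect m f <= expect m g.
Proof.
by move=> bf bg fg; apply: le_Rintegral => //; exact: bmeas_integrable.
Qed.

Lemma expect_ge0 f : (forall x, 0 <= f x) -> 0 <= expect m f.
Proof. by move=> f0; apply: Rintegral_ge0. Qed.

Lemma expect_norm_le f g : bmeas f -> bmeas g -> (forall x, `|f x| <= g x) ->
  `|expect m f| <= expect m g.
Proof.
move=> bf bg fg; rewrite ler_norml; apply/andP; split.
  rewrite -[leLHS]mulN1r -expectZ//; apply: expect_le => //; first exact: bmeasZ.
  by move=> x; rewrite mulN1r; have := fg x; rewrite ler_norml => /andP[].
by apply: expect_le => // x; apply: le_trans (fg x); exact: ler_norm.
Qed.

Lemma expect_norm_cst f (M : R) : bmeas f -> (forall x, `|f x| <= M) ->
  `|expect m f| <= M * fine (m setT).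
Proof.
by move=> bf fM; rewrite -expect_cst; apply: expect_norm_le => //; exact: bmeas_cst.
Qed.

Lemma mass_ge0 : 0 <= fine (m setT).
Proof. exact: fine_ge0. Qed.

Lemma finite_le (A : set K) : measurable (A : set (Bor K)) -> (m A < +oo)%E.
Proof. by move=> mA; apply: le_lt_trans fm; apply: le_measure; rewrite ?inE. Qed.

Lemma finite_fin (A : set K) : measurable (A : set (Bor K)) -> m A \is a fin_num.
Proof. by move=> mA; rewrite ge0_fin_numE//; exact: finite_le. Qed.

Lemma expect_sum (I : Type) (s : seq I) (F : I -> K -> R) :
  (forall i, bmeas (F i)) ->
  bmeas (fun x => \sum_(i <- s) F i x) /\
  expect m (fun x => \sum_(i <- s) F i x) = \sum_(i <- s) expect m (F i).
Proof.
move=> bF; elim: s => [|i s [bs IH]].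
  rewrite big_nil; split; first by under eq_fun do rewrite big_nil; exact: bmeas_cst.
  by under eq_fun do rewrite big_nil; rewrite expect_cst mul0r.
split; first by under eq_fun do rewrite big_cons; exact: bmeasD.
by under eq_fun do rewrite big_cons; rewrite expectD// IH big_cons.
Qed.

End finite.

(* No measurability is assumed: the integral of a nonnegative function is
   a supremum over the simple functions below it. *)
Lemma le_lower_integral m (f g : Bor K -> \bar R) :
  (forall x, 0 <= f x)%E -> (forall x, f x <= g x)%E ->
  (\int[m]_x f x <= \int[m]_x g x)%E.
Proof.
move=> f0 fg; rewrite !ge0_integralTE//; last by move=> x; apply: le_trans (fg x).
apply: le_ereal_sup => _ [h hf <-]; exists h => //= x.
exact: le_trans (hf x) (fg x).
Qed.

End Expectation.

(** * Radon measures on locally compact Hausdorff spaces *)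

Section LocallyCompact.
Context {R : realType} {K : ptopologicalType}.
Hypothesis lcK : locally_compact [set: K].
Hypothesis hdK : hausdorff_space K.

Lemma lc_compact_nbhs (x : K) : exists2 C : set K, compact C & nbhs x C.
Proof.
have := lcK (x := x) I; rewrite withinET => -[C Cx [cC _]]; by exists C.
Qed.

Lemma compact_subset_interior (C : set K) : compact C ->
  exists2 D : set K, compact D & C `<=` D°.
Proof.
rewrite {1}compact_cover => cC.
have /choice[W hW] : forall x : K, exists D : set K, compact D /\ nbhs x D.
  by move=> x; have [D] := lc_compact_nbhs x; exists D.
have [|x Cx|s _ Cs] := cC K setT (fun x => (W x)°).
- by move=> i _; exact: open_interior.
- by exists x => //; exact: (hW x).2.
exists (\big[setU/set0]_(x <- finmap.enum_fset s) W x).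
  by apply: bigsetU_compact => i _; exact: (hW i).1.
move=> x /Cs[y /= ys Wyx].
rewrite /interior; apply: filterS Wyx => z Wz.
by rewrite -bigcup_seq; exists y.
Qed.

(** The one-point compactification is compact Hausdorff, hence normal, and there [C] is separated
    from the complement of [U] intersected with the interior of a compact neighbourhood [D] of [C].
    Cutting down to [D] gives the compact support. *)
Lemma urysohn_Cc (C U : set K) : compact C -> open U -> C `<=` U ->
  exists f : K -> R, [/\ Cc f, forall x, 0 <= f x <= 1,
    forall x, C x -> f x = 1 & forall x, ~ U x -> f x = 0].
Proof.
move=> cC oU CU; have [D cD CD] := compact_subset_interior cC.
pose oK := one_point_compactification K.
have hO : hausdorff_space oK by exact: one_point_compactification_hausdorff.
have nO : normal_space oK.
  by apply: compact_normal => //; exact: one_point_compactification_compact.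
have cS : continuous (Some : K -> oK).
  exact: one_point_compactification_some_continuous.
pose A : set oK := Some @` C.
have clA : closed A.
  apply: compact_closed => //; apply: continuous_compact => //.
  exact: continuous_subspaceT.
pose B : set oK := ~` (Some @` (U `&` D°)).
have clB : closed B.
  apply: open_closedC; apply: one_point_compactification_open_some.
  by apply: openI => //; exact: open_interior.
have AB : A `&` B = set0.
  rewrite -subset0 => _ [[x Cx <-]]; apply; exists x => //.
  by split; [exact: CU|exact: CD].
have := normal_uniform_separator nO clA clB AB.
move=> /(uniform_separatorP (R := R))[g [cg g01 g0 g1]].
pose f x := g (Some x).
have cf : continuous f by move=> x; exact: (cvg_comp _ _ (cS x) (cg (Some x))).
have f0 x : C x -> f x = 0 by move=> Cx; apply: g0; exists (Some x) => //; exists x.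
have f1 x : ~ (U `&` D°) x -> f x = 1.
  by move=> Ux; apply: g1; exists (Some x) => // -[y Uy [yx]]; apply: Ux; rewrite -yx.
have rf x : 0 <= f x <= 1.
  by have /g01 : range g (f x) by [exists (Some x)]; rewrite /= in_itv.
(* The separating function is 0 on [C] and 1 off [U] and at infinity, so it is reversed. *)
exists (fun x => 1 - f x); split.
- split; first by move=> x; apply: cvgB; [exact: cvg_cst | exact: cf].
  exists D; split=> // x Dx; suff -> : f x = 1 by rewrite subrr.
  by apply: f1 => -[_ /interior_subset].
- by move=> x; have /andP[? ?] := rf x; rewrite subr_ge0 gerBl; apply/andP.
- move=> x Cx; suff -> : f x = 0 by rewrite subr0.
  exact: f0.
- move=> x Ux; suff -> : f x = 1 by rewrite subrr.
  by apply: f1 => -[].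
Qed.

Lemma Cc_Cb (f : K -> R) : Cc f -> Cb f.
Proof.
move=> [cf [C [cC fC]]]; split => //.
have /compact_bounded[M [_ hM]] : compact (f @` C).
  by apply: continuous_compact => //; exact: continuous_subspaceT.
exists (`|M| + 1) => x; have [Cx|/fC ->] := pselect (C x); last by rewrite normr0 addr_ge0.
apply: hM; last by exists x.
by rewrite (le_lt_trans (ler_norm _))// ltrDl.
Qed.

Lemma compact_Bor (C : set K) : compact C -> measurable (C : set (Bor K)).
Proof. by move=> cC; apply: closed_Bor; exact: compact_closed. Qed.

Section radon.
Variable m : pmeas R K.
Hypotheses (rm : radon m) (fm : finite_meas m).

(** Inner regularity at the open set [setT], whose mass is finite. *)
Lemma radon_tight (eps : R) : 0 < eps ->
  exists2 C : set K, compact C & fine (m (~` C)) <= eps.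
Proof.
move=> e0; have [_ _ /(_ setT openT) mT] := rm.
have fT : m setT \is a fin_num by exact: finite_fin.
have : (m setT - eps%:E < m setT)%E by rewrite lteBlDr// lteDl// lte_fin.
rewrite {2}mT => /ereal_sup_gt[_ [C [cC _] <-]] h; exists C => //.
have mC := compact_Bor cC.
rewrite -setTD measureD//.
rewrite setTI fineB//; last exact: finite_fin.
have fC : m C \is a fin_num by exact: finite_fin.
move: h; rewrite lteBlDr// -(fineK fT) -(fineK fC) -EFinD lte_fin.
by rewrite lerBlDl => /ltW.
Qed.

(** A union of uncountably many null open sets need not be visibly null. Inner regularity reduces
    the claim to compact subsets of [U], which finitely many null open sets cover. *)
Lemma radon_supp_null (U : set K) : open U -> U `&` msupport m = set0 -> m U = 0%E.
Proof.
move=> oU US; have [_ _ /(_ U oU) ->] := rm.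
apply/eqP; rewrite eq_le; apply/andP; split; last first.
  apply: ereal_sup_ubound; exists set0; last by rewrite measure0.
  by split; [exact: compact0 | exact: sub0set].
apply: ge_ereal_sup => _ [C [cC CU] <-].
have /choice[W hW] : forall x : K, exists V : set K,
    open V /\ (C x -> V x /\ m V = 0%E).
  move=> x; have [Cx|nC] := pselect (C x); last by exists setT; split=> //; exact: openT.
  have /existsNP[V /not_implyP[oV /not_implyP[Vx /negP]]] : ~ msupport m x.
    by move=> Sx; have : (U `&` msupport m) x by [split; [exact: CU|]]; rewrite US.
  rewrite -leNgt => mV; exists V; split => // _; split => //.
  by apply/eqP; rewrite eq_le mV measure_ge0.
move: (cC); rewrite compact_cover => /(_ K C W)[i _|x Cx|s sC Cs].
- exact: (hW i).1.
- by exists x => //; exact: ((hW x).2 Cx).1.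
have mW (i : K) : measurable (W i : set (Bor K)) by apply: open_Bor; exact: (hW i).1.
have sub : m C = m (C `&` \big[setU/set0]_(i <- finmap.enum_fset s) W i).
  by congr (m _); apply/esym/setIidPl; rewrite -bigcup_seq.
have mB : measurable (\big[setU/set0]_(i <- finmap.enum_fset s) W i : set (Bor K)).
  by apply: bigsetU_measurable => i _; exact: mW.
apply: (@le_trans _ _ (m (\big[setU/set0]_(i <- finmap.enum_fset s) W i))).
  by rewrite sub; apply: le_measure; rewrite ?inE//;
    apply: measurableI => //; exact: compact_Bor.
have {sub Cs} : forall i, i \in (finmap.enum_fset s) -> m (W i) = 0%E.
  by move=> i /sC; rewrite inE => Ci; exact: ((hW i).2 Ci).2.
elim: (finmap.enum_fset s) => [_|i l IH h]; first by rewrite big_nil measure0.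
rewrite big_cons; apply: (le_trans (measureU2 _ _ _)) => //.
  by apply: bigsetU_measurable => j _; exact: mW.
rewrite [X in (X + _)%E](h i (mem_head _ _)) add0e; apply: IH => j jl; apply: h.
by rewrite inE jl orbT.
Qed.

Lemma expect_supp0 (f : K -> R) : Cb f -> (forall x, msupport m x -> f x = 0) ->
  expect m f = 0.
Proof.
move=> bf f0; have [cf [M hM]] := bf.
pose U := [set x | f x != 0].
have oU : open U.
  rewrite (_ : U = f @^-1` (~` [set 0])); last first.
    by apply/seteqP; split => x /=; [move/eqP|move/eqP].
  apply: open_comp; first by move=> x _; exact: cf.
  apply: closed_openC; exact: closed_eq.
have mU : m U = 0%E.
  apply: radon_supp_null => //; rewrite -subset0 => x [Ux /f0 fx].
  by move: Ux; rewrite /U /= fx eqxx.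
apply/eqP; rewrite -normr_le0.
have -> : 0 = expect m (fun x => M * \1_U x).
  rewrite expectZ//; last by apply: bmeas_indic; exact: open_Bor.
  by rewrite expect_indic ?mU ?mulr0//; exact: open_Bor.
apply: expect_norm_le => //; first exact: Cb_bmeas.
  by apply: bmeasZ; apply: bmeas_indic; exact: open_Bor.
move=> x; rewrite indicE; have [xU|xU] := boolP (x \in U); first by rewrite mulr1.
by move: xU; rewrite notin_setE /U /= => /negP; rewrite negbK => /eqP ->; rewrite normr0 mulr0.
Qed.

End radon.

(** The equality case of the maximum principle: if [f x < M] at a point of the support, the open set
    [U] where [f < M - d] has positive mass, and [f <= M - d * \1_U] pushes the mean strictly below
    [M]. *)
Lemma expect_max_supp (m : pmeas R K) (f : K -> R) (M : R) :
  m setT = 1%E -> Cb f -> (forall x, f x <= M) -> expect m f = M ->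
  forall x, msupport m x -> f x = M.
Proof.
move=> m1 bf fM mfM x Sx; apply/eqP; rewrite eq_le fM /= leNgt; apply/negP => fx.
have fm : finite_meas m by rewrite /finite_meas m1 ltry.
have [cf _] := bf.
pose d := (M - f x) / 2; have d0 : 0 < d by rewrite divr_gt0// subr_gt0.
pose U := [set y | f y < M - d].
have oU : open U.
  apply: (@open_comp _ _ f [set t | t < M - d]); last exact: open_lt.
  by move=> y _; exact: cf.
have mU : (0 < m U)%E by apply: Sx => //; rewrite /U /= /d; lra.
have bm := Cb_bmeas bf.
have bU : bmeas (\1_U : K -> R) by apply: bmeas_indic; exact: open_Bor.
have : expect m f <= expect m (fun y => M - d * \1_U y).
  apply: expect_le => //; first by apply: bmeasB; [exact: bmeas_cst|exact: bmeasZ].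
  move=> y; rewrite indicE; have [yU|yU] := boolP (y \in U).
    by rewrite mulr1; apply: ltW; move: yU; rewrite inE.
  by rewrite mulr0 subr0.
rewrite expectB//; [|exact: bmeas_cst|exact: bmeasZ].
rewrite mfM expectZ// expect_cst m1 mulr1 expect_indic//; last exact: open_Bor.
rewrite lerBrDl gerDr; apply/negP; rewrite -ltNge mulr_gt0// fine_gt0// mU/=.
by apply: finite_le => //; exact: open_Bor.
Qed.

(** For every open [U] containing [C], a Urysohn function between them gives
    [P C <= expect P f = expect N f <= N U]; outer regularity of [N] concludes. *)
Lemma radon_le_compact (P N : pmeas R K) : finite_meas P -> finite_meas N -> radon N ->
  (forall f : K -> R, Cc f -> (forall x, 0 <= f x <= 1) -> expect P f = expect N f) ->
  forall C : set K, compact C -> (P C <= N C)%E.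
Proof.
move=> fP fN [_ rN _] PN C cC; rewrite (rN C (compact_Bor cC)).
apply: le_ereal_inf_tmp => _ [U [oU CU] <-].
have [f [ccf f01 fC fU]] := urysohn_Cc cC oU CU.
have bf := Cb_bmeas (Cc_Cb ccf).
rewrite -(fineK (finite_fin fP (compact_Bor cC))) -(fineK (finite_fin fN (open_Bor oU))).
rewrite lee_fin -(expect_indic P (compact_Bor cC)) -(expect_indic N (open_Bor oU)).
apply: (@le_trans _ _ (expect P f)).
  apply: expect_le => //; first by apply: bmeas_indic; exact: compact_Bor.
  move=> x; rewrite indicE; have [/set_mem/fC ->//|_] := boolP (x \in C).
  by have /andP[] := f01 x.
rewrite PN//; apply: expect_le => //; first by apply: bmeas_indic; exact: open_Bor.
move=> x; rewrite indicE; have [_|] := boolP (x \in U).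
  by have /andP[] := f01 x.
by rewrite notin_setE => /fU ->.
Qed.

Lemma radon_eq (P N : pmeas R K) :
  finite_meas P -> finite_meas N -> radon P -> radon N ->
  (forall f : K -> R, Cc f -> (forall x, 0 <= f x <= 1) -> expect P f = expect N f) ->
  forall A : set (Bor K), measurable A -> P A = N A.
Proof.
move=> fP fN rP rN PN.
have eC (C : set K) : compact C -> P C = N C.
  move=> cC; apply/eqP; rewrite eq_le !radon_le_compact//.
  by move=> f cf f01; rewrite PN.
have eU (U : set K) : open U -> P U = N U.
  move=> oU; have [_ _ ->//] := rP; have [_ _ ->//] := rN.
  by congr ereal_sup; apply: eq_imagel => C [cC _]; exact: eC.
move=> A mA; have [_ -> // _] := rP; have [_ -> // _] := rN.
by congr ereal_inf; apply: eq_imagel => U [oU _]; exact: eU.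
Qed.

End LocallyCompact.

(** * From set functions to continuous functions *)

Section LayerCake.
Context {R : realType} {K : ptopologicalType}.

Lemma CbD (f g : K -> R) : Cb f -> Cb g -> Cb (fun x => f x + g x).
Proof.
move=> [cf [M hM]] [cg [N hN]]; split.
  by move=> x; apply: cvgD; [exact: cf|exact: cg].
by exists (M + N) => x; rewrite (le_trans (ler_normD _ _))// lerD.
Qed.

Lemma CbZ (c : R) (f : K -> R) : Cb f -> Cb (fun x => c * f x).
Proof.
move=> [cf [M hM]]; split.
  by move=> x; apply: cvgM; [exact: cvg_cst|exact: cf].
by exists (`|c| * M) => x; rewrite normrM ler_wpM2l.
Qed.

Lemma Cb_cst (c : R) : Cb (fun _ : K => c).
Proof. by split; [move=> x; exact: cvg_cst|exists `|c|]. Qed.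

Lemma CbB (f g : K -> R) : Cb f -> Cb g -> Cb (fun x => f x - g x).
Proof.
move=> bf bg; have := CbD bf (CbZ (-1) bg).
by congr Cb; apply/funext => x; rewrite mulN1r.
Qed.

Lemma Cb_min (f : K -> R) (t : R) : Cb f -> Cb (fun x => Num.min (f x) t).
Proof.
move=> [cf [M hM]]; split.
  by move=> x; apply: continuous_min; [exact: cf|exact: cvg_cst].
exists (M + `|t|) => x; have := hM x.
by case: (leP (f x) t) => _ h; [rewrite (le_trans h)// lerDl|rewrite lerDr (le_trans _ h)].
Qed.

Lemma min_addr_itv (s t d : R) : 0 < d ->
  0 <= Num.min s (t + d) - Num.min s t <= d.
Proof.
move=> d0; apply/andP; rewrite /Num.min.
by split; case: ltP => h1; case: ltP => h2; lra.
Qed.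

(** A Riemann sum of mesh [1 / N.+1] for the layer-cake integral of [a [f > t]] over [t] in
    [[0, 1]]. *)
Definition layer_sum (a : set K -> R) (f : K -> R) (N : nat) : R :=
  N.+1%:R^-1 * \sum_(0 <= k < N.+1) a [set x | k%:R / N.+1%:R < f x].

(** An approximate layer-cake formula: on functions with values in [[0, 1]], [L] is determined by
    the values of [a] on open superlevel sets. The constant may depend on [f] but not on [N]. *)
Definition layered (L : (K -> R) -> R) (a : set K -> R) :=
  forall f, Cb f -> (forall x, 0 <= f x <= 1) ->
  exists c : R, forall N, `|L f - layer_sum a f N| <= c / N.+1%:R.

(* Identities between set functions pass to continuous functions by writing
   [f] as the mean of the continuous layers [N (min f (k+1)/N - min f (k/N))],
   which lie between the indicators of [f > (k+1)/N] and [f > k/N]. Only the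
   monotonicity of the set function enters, never its measurability. *)
Lemma layered_sandwich (L : (K -> R) -> R) (a : set K -> R) :
  (forall f g, Cb f -> Cb g -> L (fun x => f x + g x) = L f + L g) ->
  (forall c f, Cb f -> L (fun x => c * f x) = c * L f) ->
  (forall f V U, Cb f -> open V -> open U -> (forall x, 0 <= f x <= 1) ->
    (forall x, V x -> f x = 1) -> (forall x, ~ U x -> f x = 0) ->
    a V <= L f <= a U) ->
  layered L a.
Proof.
move=> LD LZ La f bf f01.
(* The telescoped gap between the upper sum over [A k] and the lower sum over [A k.+1]. The second
   set is empty, but [a set0] is not assumed to be 0. *)
exists (a [set x | 0 < f x] - a [set x | 1 < f x]) => N.
pose n : R := N.+1%:R; have n0 : 0 < n by rewrite ltr0n.
have nn0 : n != 0 by rewrite gt_eqF.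
pose t (k : nat) : R := k%:R / n.
have tS k : t k.+1 = t k + n^-1 by rewrite /t -natr1 mulrDl mul1r.
have ni0 : 0 < n^-1 by rewrite invr_gt0.
pose psi (k : nat) x := n * (Num.min (f x) (t k.+1) - Num.min (f x) (t k)).
have bpsi k : Cb (psi k) by apply: CbZ; apply: CbB; exact: Cb_min.
pose A k := a [set x | t k < f x].
have oA k : open [set x | t k < f x].
  apply: (@open_comp _ _ f [set s | t k < s]); last exact: open_gt.
  by move=> y _; exact: bf.1.
have psiA k : A k.+1 <= L (psi k) <= A k.
  apply: La => //.
  - move=> x; rewrite /psi tS.
    rewrite -[X in _ <= _ <= X](mulfV nn0) ler_pM2l// pmulr_rge0//.
    exact: min_addr_itv.
  - move=> x /= h; have h' : t k < f x by apply: lt_trans h; rewrite tS ltrDl.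
    by rewrite /psi /Num.min !ltNge (ltW h) (ltW h') /= tS addrAC subrr add0r mulfV.
  - move=> x /= /negP; rewrite -leNgt => h.
    have h' : f x <= t k.+1 by rewrite tS (le_trans h)// lerDl ltW.
    by rewrite /psi !min_l// subrr mulr0.
have Lsum m : Cb (fun x => \sum_(0 <= k < m) psi k x) /\
    L (fun x => \sum_(0 <= k < m) psi k x) = \sum_(0 <= k < m) L (psi k).
  elim: m => [|m [IH1 IH2]].
    under eq_fun do rewrite big_nil; rewrite big_nil; split; first exact: Cb_cst.
    (* Homogeneity with the scalar 0 yields [L 0 = 0]. *)
    have -> : (fun _ : K => 0 : R) = (fun=> 0 * 0) by apply/funext => x; rewrite mul0r.
    by rewrite (LZ 0 _ (Cb_cst 0)) mul0r.
  under eq_fun do rewrite big_nat_recr//=; rewrite big_nat_recr//=.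
  by split; [exact: CbD|rewrite LD// IH2].
have Lf : L f = n^-1 * \sum_(0 <= k < N.+1) L (psi k).
  rewrite -(Lsum N.+1).2 -LZ; last exact: (Lsum _).1.
  congr L; apply/funext => x; rewrite /psi -mulr_sumr mulKf//.
  rewrite telescope_sumr//= /t mul0r divff//.
  by have /andP[h0 h1] := f01 x; rewrite min_l// min_r// subr0.
have -> : layer_sum a f N = n^-1 * \sum_(0 <= k < N.+1) A k by [].
have A0N : a [set x | 0 < f x] - a [set x | 1 < f x] =
    \sum_(0 <= k < N.+1) A k - \sum_(0 <= k < N.+1) A k.+1.
  have := @telescope_sumr _ 0 N.+1 A (leq0n _); rewrite sumrB => /eqP.
  rewrite -[X in X == _]opprB eqr_oppLR opprB => /eqP ->.
  by rewrite /A /t mul0r divff.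
(* The layer sum is the upper sum, and [L f] lies between it and the lower sum. *)
rewrite A0N Lf -mulrBr normrM gtr0_norm// mulrC ler_pM2r//.
rewrite distrC ger0_norm; last first.
  by rewrite subr_ge0; apply: ler_sum => k _; have /andP[] := psiA k.
by rewrite lerB//; apply: ler_sum => k _; have /andP[] := psiA k.
Qed.

Lemma archi_le0 (X c : R) : (forall N, `|X| <= c / N.+1%:R) -> X = 0.
Proof.
move=> h; apply/eqP; rewrite -normr_le0 leNgt; apply/negP => X0.
have := archi_boundP (_ : 0 <= `|c| / `|X|); rewrite divr_ge0// => /(_ isT).
set N := Num.bound _; rewrite ltr_pdivrMr// => cN.
have := h N; rewrite leNgt => /negP; apply.
rewrite ltr_pdivrMr ?ltr0n// (le_lt_trans (ler_norm _))// (lt_le_trans cN)//.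
by rewrite mulrC ler_pM2l// ler_nat.
Qed.

(** Layer sums evaluate the set functions only on open sets, where the identity is exact; the two
    sides thus differ by [O(1/N)] for every [N]. Four functionals are needed for differences [P - N]
    on both sides. *)
Lemma layered_eq (L1 L2 L3 L4 : (K -> R) -> R) (a1 a2 a3 a4 : set K -> R) :
  layered L1 a1 -> layered L2 a2 -> layered L3 a3 -> layered L4 a4 ->
  (forall U, open U -> a1 U - a2 U = a3 U - a4 U) ->
  forall f, Cb f -> (forall x, 0 <= f x <= 1) -> L1 f - L2 f = L3 f - L4 f.
Proof.
move=> l1 l2 l3 l4 aU f bf f01.
have [c1 h1] := l1 f bf f01; have [c2 h2] := l2 f bf f01.
have [c3 h3] := l3 f bf f01; have [c4 h4] := l4 f bf f01.
apply/eqP; rewrite -subr_eq0; apply/eqP.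
apply: (@archi_le0 _ (c1 + c2 + c3 + c4)) => N.
have : layer_sum a1 f N - layer_sum a2 f N = layer_sum a3 f N - layer_sum a4 f N.
  rewrite /layer_sum -!mulrBr -!sumrB; congr (_ * _); apply: eq_bigr => k _.
  apply: aU; apply: (@open_comp _ _ f [set s | k%:R / N.+1%:R < s]); last exact: open_gt.
  by move=> y _; exact: bf.1.
have := h1 N; have := h2 N; have := h3 N; have := h4 N.
rewrite !mulrDl.
move: (c1 / _) (c2 / _) (c3 / _) (c4 / _) => e1 e2 e3 e4.
rewrite !ler_norml => /andP[? ?] /andP[? ?] /andP[? ?] /andP[? ?] ?.
by apply/andP; split; lra.
Qed.

End LayerCake.

(** * Iterated integrals of continuous functions *)

Section Discretisation.
Context {R : realType} {K : ptopologicalType}.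
Hypothesis lcK : locally_compact [set: K].
Hypothesis hdK : hausdorff_space K.

Section one_measure.
Variable rho : pmeas R K.
Hypotheses (frho : finite_meas rho) (rrho : radon rho).
Let mass := fine (rho setT).

(** The cover is made disjoint in the order of [l]: on [A] intersected with [V i], [u] is replaced
    by [u i] with the mass of that piece as weight, and the rest of [A] is left to the tail. The
    weights and nodes are fixed before [u]. *)
Lemma discretise_cover (V : K -> set K) (l : seq K) (A : set K) :
  (forall x, open (V x)) -> measurable (A : set (Bor K)) ->
  (forall x, A x -> exists2 i, i \in l & V i x) ->
  exists s : seq (R * K), forall (u : K -> R) (d : R), bmeas u -> 0 <= d ->
    (forall i x, V i x -> `|u x - u i| <= d) ->
    `|expect rho (fun x => u x * \1_A x) - \sum_(p <- s) p.1 * u p.2|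
      <= d * fine (rho A).
Proof.
move=> oV; elim: l A => [|i l IH] A mA Al.
  have A0 : A = set0 by rewrite -subset0 => x /Al[].
  exists [::] => u d bu d0 _; rewrite big_nil subr0 A0 measure0 mulr0.
  under eq_fun do rewrite indic0 mulr0.
  by rewrite expect_cst mul0r normr0.
have mA1 : measurable (A `&` V i : set (Bor K)).
  by apply: measurableI => //; exact: open_Bor.
have mA2 : measurable (A `\` V i : set (Bor K)).
  by apply: measurableD => //; exact: open_Bor.
have [|s hs] := IH (A `\` V i) mA2.
  move=> x [Ax nV]; have [j] := Al x Ax.
  by rewrite inE => /orP[/eqP ->//|jl Vj]; exists j.
exists ((fine (rho (A `&` V i)), i) :: s) => u d bu d0 hu.
have b1 : bmeas (\1_(A `&` V i) : K -> R) by exact: bmeas_indic.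
have b2 : bmeas (\1_(A `\` V i) : K -> R) by exact: bmeas_indic.
have -> : (fun x => u x * \1_A x) =
    (fun x => u x * \1_(A `&` V i) x + u x * \1_(A `\` V i) x).
  apply/funext => x; rewrite -mulrDr; congr (_ * _).
  rewrite !indicE in_setI in_setD.
  by case: (x \in A); case: (x \in V i); rewrite /= ?addr0 ?add0r.
rewrite expectD; [|by []|exact: bmeasM|exact: bmeasM].
rewrite big_cons /=.
have h1 : `|expect rho (fun x => u x * \1_(A `&` V i) x) - fine (rho (A `&` V i)) * u i|
    <= d * fine (rho (A `&` V i)).
  rewrite -(expect_indic rho mA1) [X in _ - X]mulrC -(expectZ frho (u i) b1).
  rewrite -expectB; [|by []|exact: bmeasM|exact: bmeasZ].
  rewrite -expectZ//; apply: expect_norm_le => //.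
  - by apply: bmeasB; [exact: bmeasM|exact: bmeasZ].
  - exact: bmeasZ.
  - move=> x; rewrite -mulrBl normrM indicE.
    have [|_] := boolP (x \in _); last by rewrite normr0 !mulr0.
    by rewrite inE normr1 !mulr1 => -[_ /hu].
have h2 := hs u d bu d0 hu.
have -> : fine (rho A) = fine (rho (A `&` V i)) + fine (rho (A `\` V i)).
  rewrite -fineD; [|exact: finite_fin|exact: finite_fin].
  by rewrite addeC -measureDI//; exact: open_Bor.
rewrite mulrDr opprD addrACA (le_trans (ler_normD _ _))// lerD//.
Qed.

(* The nodes do not depend on [u]: they serve for [F (_, y)], uniformly in
   [y \in D], and for the partial integral of [F] over its second variable.
   Continuity of partial integrals and the exchange of integrals follow. *)
Lemma discretise (F : K * K -> R) (D : set K) (eps : R) :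
  continuous F -> compact D -> 0 < eps ->
  exists s : seq (R * K), forall (u : K -> R) (B d : R),
    bmeas u -> (forall x, `|u x| <= B) -> 0 <= d ->
    (forall x x', (forall y, D y -> `|F (x, y) - F (x', y)| <= eps) ->
      `|u x - u x'| <= d) ->
    `|expect rho u - \sum_(p <- s) p.1 * u p.2| <= d * mass + B * eps.
Proof.
move=> cF cD e0.
have [C cC hC] := radon_tight hdK rrho frho e0.
have mC := compact_Bor hdK cC.
have /choice[V hV] : forall x0 : K, exists V : set K, [/\ open V, V x0 &
    forall x, V x -> forall y, D y -> `|F (x, y) - F (x0, y)| <= eps].
  move=> x0; move/compact_near_coveringP : cD => cD.
  have : nbhs x0 (fun x => D `<=` (fun y => `|F (x, y) - F (x0, y)| <= eps)).
    apply: cD => y Dy.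
    have /cvgrPdist_le/(_ (eps / 2)) := cF (x0, y).
    rewrite divr_gt0// => /(_ isT) -[[/= P Q] [Px Qy] PQ].
    exists (Q, P) => //= -[y' x] /= [Qy' Px'].
    have h1 := PQ (x, y') (conj Px' Qy').
    have h2 := PQ (x0, y') (conj (nbhs_singleton Px) Qy').
    move: h1 h2; rewrite /= !ler_norml => /andP[? ?] /andP[? ?].
    by apply/andP; split; lra.
  rewrite nbhsE => -[V [oV Vx] VD]; by exists V.
have oV x : open (V x) by have [] := hV x.
move: (cC); rewrite compact_cover => /(_ K setT V)[//|x Cx|l _ Cl].
  by exists x => //; have [] := hV x.
have [|s hs] := @discretise_cover V (finmap.enum_fset l) C oV mC.
  by move=> x /Cl[i il Vx]; exists i.
exists s => u B d bu uB d0 hu.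
have mCc : measurable (~` C : set (Bor K)) by exact: measurableC.
have b1 : bmeas (\1_C : K -> R) by exact: bmeas_indic.
have b2 : bmeas (\1_(~` C) : K -> R) by exact: bmeas_indic.
(* On [C] the cover gives the error [d * mass]; off [C] the mass is at most [eps] and [u] is bounded
   by [B]. *)
have -> : expect rho u = expect rho (fun x => u x * \1_C x) +
    expect rho (fun x => u x * \1_(~` C) x).
  rewrite -expectD; [|by []|exact: bmeasM|exact: bmeasM].
  congr expect; apply/funext => x; rewrite -mulrDr !indicE in_setC.
  by case: (x \in C); rewrite /= ?addr0 ?add0r mulr1.
rewrite addrAC (le_trans (ler_normD _ _))// lerD//.
  apply: (le_trans (hs u d bu d0 _)).
    by move=> i x Vx; apply: hu => y Dy; have [_ _ ->] := hV i.
  rewrite ler_wpM2l//; apply: fine_le; [exact: finite_fin|exact: finite_fin|].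
  by apply: le_measure; rewrite ?inE.
have B0 : 0 <= B by apply: le_trans (uB point).
apply: (@le_trans _ _ (B * fine (rho (~` C)))); last by rewrite ler_wpM2l.
rewrite -(expect_indic rho mCc) -expectZ//; apply: expect_norm_le => //.
- exact: bmeasM.
- exact: bmeasZ.
- by move=> x; rewrite normrM [X in _ * X]ger0_norm ?indicE// ler_wpM2r.
Qed.

Lemma slice_Cb (F : K * K -> R) (B : R) (y : K) : continuous F ->
  (forall p, `|F p| <= B) -> Cb (fun x => F (x, y)).
Proof.
move=> cF hB; split; last by exists B.
move=> x; apply: (@cvg_comp _ _ _ (fun x : K => (x, y)) F); last exact: cF.
by apply: cvg_pair; [exact: cvg_id|exact: cvg_cst].
Qed.

Lemma slice_Cb2 (F : K * K -> R) (B : R) (x : K) : continuous F ->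
  (forall p, `|F p| <= B) -> Cb (fun y => F (x, y)).
Proof.
move=> cF hB; split; last by exists B.
move=> y; apply: (@cvg_comp _ _ _ (fun y : K => (x, y)) F); last exact: cF.
by apply: cvg_pair; [exact: cvg_cst|exact: cvg_id].
Qed.

(** Near [y0] the partial integral is within [eps / 3] of one finite combination of slices
    [F (p.2, _)], which is continuous. *)
Lemma expect_slice_Cb (F : K * K -> R) (B : R) : continuous F ->
  (forall p, `|F p| <= B) -> Cb (fun y => expect rho (fun x => F (x, y))).
Proof.
move=> cF hB; have B0 : 0 <= B by apply: le_trans (hB point).
have bF y : bmeas (fun x => F (x, y)) by apply: Cb_bmeas; exact: slice_Cb hB.
split; last by exists (B * mass) => y; exact: expect_norm_cst.
move=> y0; apply/cvgrPdist_le => /= eps e0.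
have [D cD Dy0] := lc_compact_nbhs lcK y0.
have m0 : 0 <= mass by exact: mass_ge0.
(* Chosen so that the discretisation error [e' * mass + B * e'] is at most [eps / 3]; the added 1
   keeps the denominator positive. *)
pose e' : R := eps / 3 / (mass + B + 1).
have mB : 0 < mass + B + 1 by rewrite ltr_wpDl// addr_ge0.
have e'0 : 0 < e' by rewrite /e' !divr_gt0.
have [s hs] := discretise cF cD e'0.
have h y : D y ->
    `|expect rho (fun x => F (x, y)) - \sum_(p <- s) p.1 * F (p.2, y)| <= eps / 3.
  move=> Dy; apply: (le_trans (hs (fun x => F (x, y)) B e' (bF y) _ _ _)) => //.
  - exact: ltW.
  - by move=> x x'; apply.
  - rewrite [B * _]mulrC -mulrDr.
    have mB' : mass + B + 1 != 0 by rewrite gt_eqF.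
    rewrite -[leRHS](divfK mB') -/e'.
    by rewrite ler_pM2l// lerDl.
have cs : (fun y => \sum_(p <- s) p.1 * F (p.2, y)) @ y0 -->
    \sum_(p <- s) p.1 * F (p.2, y0).
  elim: (s) => [|p l IH].
    by under eq_fun do rewrite big_nil; rewrite big_nil; exact: cvg_cst.
  under eq_fun do rewrite big_cons; rewrite big_cons; apply: cvgD => //.
  by apply: cvgM; [exact: cvg_cst|exact: (slice_Cb2 p.2 cF hB).1].
have e3 : 0 < eps / 3 by rewrite divr_gt0.
move/cvgrPdist_le : cs => /(_ _ e3) cs.
near=> y.
have Dy : D y by near: y.
have := h y Dy; have := h y0 (nbhs_singleton Dy0).
have : `|\sum_(p <- s) p.1 * F (p.2, y0) - \sum_(p <- s) p.1 * F (p.2, y)| <= eps / 3.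
  by near: y.
rewrite !ler_norml => /andP[? ?] /andP[? ?] /andP[? ?].
by apply/andP; split; lra.
Unshelve. all: by end_near.
Qed.

End one_measure.

Lemma swap_continuous (F : K * K -> R) : continuous F ->
  continuous (fun p : K * K => F (p.2, p.1)).
Proof.
move=> cF p.
apply: (@cvg_comp _ _ _ (fun p : K * K => (p.2, p.1)) F); last exact: cF.
by apply: cvg_pair; [exact: cvg_snd|exact: cvg_fst].
Qed.

Lemma expect_slice_Cb2 (rho : pmeas R K) (F : K * K -> R) (B : R) :
  finite_meas rho -> radon rho -> continuous F ->
  (forall p, `|F p| <= B) -> Cb (fun x => expect rho (fun y => F (x, y))).
Proof.
move=> fr rr cF hB.
by apply: (expect_slice_Cb fr rr (swap_continuous cF) (B := B)) => p.
Qed.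

Lemma expect_fubini (rho tau : pmeas R K) (F : K * K -> R) (B : R) :
  finite_meas rho -> radon rho -> finite_meas tau -> radon tau ->
  continuous F -> (forall p, `|F p| <= B) ->
  expect rho (fun x => expect tau (fun y => F (x, y))) =
  expect tau (fun y => expect rho (fun x => F (x, y))).
Proof.
move=> fr rr ft rt cF hB; have B0 : 0 <= B by apply: le_trans (hB point).
set mr := fine (rho setT); set mt := fine (tau setT).
have mr0 : 0 <= mr by exact: mass_ge0.
have mt0 : 0 <= mt by exact: mass_ge0.
pose G x := expect tau (fun y => F (x, y)).
pose H y := expect rho (fun x => F (x, y)).
have bF1 y : bmeas (fun x => F (x, y)) by apply: Cb_bmeas; exact: slice_Cb hB.
have bF2 x : bmeas (fun y => F (x, y)) by apply: Cb_bmeas; exact: slice_Cb2 hB.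
have bG : bmeas G by apply: Cb_bmeas; exact: expect_slice_Cb2 hB.
have bH : bmeas H by apply: Cb_bmeas; exact: expect_slice_Cb hB.
(* The constant adds the errors of [h1] and [h2] below; [eps <= 1] absorbs the quadratic term
   [B * eps * eps]. *)
suff E eps : 0 < eps <= 1 -> `|expect rho G - expect tau H| <=
    ((mt + 2 * B) * mr + B * mt + (mr + B) * mt + 2 * B * mr + B) * eps.
  apply/eqP; rewrite -subr_eq0; apply/eqP.
  apply: (@archi_le0 _ _ ((mt + 2 * B) * mr + B * mt + (mr + B) * mt + 2 * B * mr + B)).
  by move=> N; apply: E; rewrite invr_gt0 ltr0n /= invf_le1 ?ltr0n// ler1n.
move=> /andP[e0 e1].
have [D cD hD] := radon_tight hdK rt ft e0.
have mD : measurable (~` D : set (Bor K)).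
  by apply: measurableC; exact: compact_Bor.
have b1 : bmeas (\1_(~` D) : K -> R) by exact: bmeas_indic.
have off (g : K -> R) (c W : R) : 0 <= W -> bmeas g ->
    (forall y, D y -> `|g y| <= c) -> 0 <= c -> (forall y, `|g y| <= W) ->
    `|expect tau g| <= c * mt + W * eps.
  move=> W0 bg gc c0 gW.
  apply: (@le_trans _ _ (expect tau (fun y => c + W * \1_(~` D) y))).
    apply: expect_norm_le => //.
      by apply: bmeasD; [exact: bmeas_cst|exact: bmeasZ].
    move=> y; rewrite indicE in_setC; have [/set_mem Dy|nD] := boolP (y \in D).
      by rewrite mulr0 addr0 gc.
    by rewrite mulr1 (le_trans (gW y))// lerDr.
  rewrite expectD; [|by []|exact: bmeas_cst|exact: bmeasZ].
  by rewrite expect_cst expectZ// expect_indic// lerD2l ler_wpM2l.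
have [s hs] := discretise fr rr cF cD e0.
(* If two slices are [eps]-close on [D], then they are within [2 * B] off [D], where [tau] has mass
   at most [eps]; this bounds the oscillation of [G]. *)
have h1 : `|expect rho G - \sum_(p <- s) p.1 * G p.2| <=
    (eps * mt + 2 * B * eps) * mr + B * mt * eps.
  apply: hs => //; first by move=> x; exact: expect_norm_cst.
    by rewrite addr_ge0// ?mulr_ge0// ltW.
  move=> x x' hx; rewrite /G -expectB//; apply: off => //.
  - by rewrite mulr_ge0.
  - exact: bmeasB.
  - exact: ltW.
  - move=> y; rewrite (le_trans (ler_normB _ _))// mulr_natl mulr2n lerD//.
have [bS eS] : bmeas (fun y => \sum_(p <- s) p.1 * F (p.2, y)) /\
    expect tau (fun y => \sum_(p <- s) p.1 * F (p.2, y)) = \sum_(p <- s) p.1 * G p.2.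
  have [bS ->] := @expect_sum _ _ tau ft _ s (fun p y => p.1 * F (p.2, y))
    (fun p => bmeasZ p.1 (bF2 p.2)).
  by split=> //; apply: eq_bigr => p _; rewrite expectZ.
(* The nodes are used twice: with [d = eps] for [y] in [D], and with the trivial oscillation
   [d = 2 * B] for other [y]. *)
have h2 : `|expect tau H - \sum_(p <- s) p.1 * G p.2| <=
    (eps * mr + B * eps) * mt + (2 * B * mr + B * eps) * eps.
  rewrite -eS -expectB//; apply: off => //.
  - by rewrite addr_ge0// !mulr_ge0// ltW.
  - exact: bmeasB.
  - move=> y Dy; apply: (hs (fun x => F (x, y))) => //; first exact: ltW.
    by move=> x x'; apply.
  - by rewrite addr_ge0// mulr_ge0// ltW.
  - move=> y; apply: (hs (fun x => F (x, y))) => //; first by rewrite mulr_ge0.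
    move=> x x' _; rewrite (le_trans (ler_normB _ _))// mulr_natl mulr2n lerD//.
have h3 : B * eps * eps <= B * eps by rewrite ler_piMr// mulr_ge0// ltW.
move: h1 h2; rewrite !ler_norml => /andP[? ?] /andP[? ?].
by apply/andP; split; nra.
Qed.

End Discretisation.

(** * Layer-cake formulas for iterated integrals *)

Section LayeredExpectation.
Context {R : realType} {K : ptopologicalType}.

Definition between (V : set K) (f : K -> R) (U : set K) :=
  [/\ forall x, 0 <= f x <= 1, forall x, V x -> f x = 1 &
      forall x, ~ U x -> f x = 0].

Lemma between_expect (m : pmeas R K) (V U : set K) (f : K -> R) :
  finite_meas m -> Cb f -> open V -> open U -> between V f U ->
  (m V <= (expect m f)%:E <= m U)%E.
Proof.
move=> fm bf oV oU [f01 fV fU].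
rewrite -(fineK (finite_fin fm (open_Bor oV))) -(fineK (finite_fin fm (open_Bor oU))).
rewrite !lee_fin -(expect_indic m (open_Bor oV)) -(expect_indic m (open_Bor oU)).
have bm := Cb_bmeas bf.
apply/andP; split; apply: expect_le => //; try (apply: bmeas_indic; exact: open_Bor).
  move=> x; rewrite indicE; have [/set_mem/fV ->//|_] := boolP (x \in V).
  by have /andP[] := f01 x.
move=> x; rewrite indicE; have [_|] := boolP (x \in U).
  by have /andP[] := f01 x.
by rewrite notin_setE => /fU ->.
Qed.

(** Integrating the pointwise sandwich requires only monotonicity of the integral, so [a U] may be
    non-measurable in [x]; the bound by 1 keeps its integral finite. *)
Lemma layered_expect (m : pmeas R K) (T : (K -> R) -> K -> R)
    (a : set K -> K -> \bar R) :
  finite_meas m ->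
  (forall f, Cb f -> Cb (T f)) ->
  (forall f g x, Cb f -> Cb g -> T (fun x => f x + g x) x = T f x + T g x) ->
  (forall c f x, Cb f -> T (fun x => c * f x) x = c * T f x) ->
  (forall V f U x, Cb f -> open V -> open U -> between V f U ->
    (a V x <= (T f x)%:E <= a U x)%E) ->
  (forall U x, open U -> 0 <= a U x <= 1)%E ->
  layered (fun f => expect m (T f)) (fun U => fine (\int[m]_x a U x)%E).
Proof.
move=> fm TC TD TZ Ta a01.
have ai U : open U -> (\int[m]_x a U x)%E \is a fin_num.
  move=> oU; rewrite ge0_fin_numE; last first.
    by apply: integral_ge0 => x _; have /andP[] := a01 U x oU.
  apply: (@le_lt_trans _ _ (\int[m]_x cst 1 x)%E).
    by apply: le_lower_integral => x; have /andP[] := a01 U x oU.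
  by rewrite integral_cst// mul1e.
apply: layered_sandwich.
- move=> f g bf bg; rewrite -expectD//; [|exact/Cb_bmeas/TC|exact/Cb_bmeas/TC].
  by congr expect; apply/funext => x; exact: TD.
- move=> c f bf; rewrite -expectZ//; last exact/Cb_bmeas/TC.
  by congr expect; apply/funext => x; exact: TZ.
- move=> f V U bf oV oU f01 fV fU.
  have vfu : between V f U by split.
  have bT : bmeas (T f) by exact/Cb_bmeas/TC.
  rewrite -!lee_fin expectK// !fineK ?ai//; apply/andP; split.
    apply: le_lower_integral => x; first by have /andP[] := a01 V x oV.
    by have /andP[] := Ta V f U x bf oV oU vfu.
  apply: le_lower_integral => x; last by have /andP[] := Ta V f U x bf oV oU vfu.
  by have /andP[+ _] := Ta V f U x bf oV oU vfu; apply: le_trans; have /andP[] := a01 V x oV.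
Qed.

Lemma layered_measure (m : pmeas R K) : finite_meas m ->
  layered (expect m) (fun U => fine (m U)).
Proof.
move=> fm; apply: layered_sandwich.
- by move=> f g /Cb_bmeas bf /Cb_bmeas bg; exact: expectD.
- by move=> c f /Cb_bmeas bf; exact: expectZ.
- move=> f V U bf oV oU f01 fV fU.
  have vfu : between V f U by split.
  have := between_expect fm bf oV oU vfu.
  by rewrite -(fineK (finite_fin fm (open_Bor oV)))
    -(fineK (finite_fin fm (open_Bor oU))) !lee_fin.
Qed.

(** Fills the subtracted slots of [layered_eq] when a plain equality is transferred. *)
Lemma layered0 : layered (fun _ : K -> R => 0) (fun _ : set K => 0).
Proof.
move=> f _ _; exists 0 => N.
by rewrite /layer_sum big1// mulr0 subr0 normr0 mul0r.
Qed.

End LayeredExpectation.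

(** * Hypergroups *)

Section Hypergroup.
Context {R : realType} {K : ptopologicalType}.
Variables (conv : K -> K -> pmeas R K) (e : K) (inv : K -> K).
Hypothesis hK : is_hypergroup conv e inv.

Let lcK := hg_lc hK.
Let hdK := hg_hausdorff hK.

Lemma conv_finite x y : finite_meas (conv x y).
Proof. by rewrite /finite_meas (hg_prob hK) ltry. Qed.

Lemma conv_radon x y : radon (conv x y).
Proof. exact: (hg_radon hK). Qed.

Lemma conv_le1 x y (A : set K) : measurable (A : set (Bor K)) ->
  (0 <= conv x y A <= 1)%E.
Proof.
move=> mA; rewrite measure_ge0/= -(hg_prob hK x y).
by apply: le_measure; rewrite ?inE.
Qed.

Definition pairing (f : K -> R) (p : K * K) : R := expect (conv p.1 p.2) f.

Lemma pairing_continuous f : Cb f -> continuous (pairing f).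
Proof. exact: (hg_weak_cont hK). Qed.

Lemma pairing_bound f (M : R) : Cb f -> (forall x, `|f x| <= M) ->
  forall p, `|pairing f p| <= M.
Proof.
move=> bf fM p; rewrite /pairing.
have := expect_norm_cst (conv_finite p.1 p.2) (Cb_bmeas bf) fM.
by rewrite (hg_prob hK) mulr1.
Qed.

Lemma expect_conv_itv f x y : Cb f -> (forall x, 0 <= f x <= 1) ->
  0 <= expect (conv x y) f <= 1.
Proof.
move=> bf f01; rewrite expect_ge0/=; last by move=> z; have /andP[] := f01 z.
apply: le_trans (ler_norm _) _; apply: (pairing_bound bf _ (x, y)) => z.
by have /andP[h0 h1] := f01 z; rewrite ger0_norm.
Qed.

Lemma right_translate_Cb f y : Cb f -> Cb (fun x => expect (conv x y) f).
Proof.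
move=> bf; have [_ [M hM]] := bf.
exact: (slice_Cb y (pairing_continuous bf) (pairing_bound bf hM)).
Qed.

Lemma left_translate_Cb f x : Cb f -> Cb (fun y => expect (conv x y) f).
Proof.
move=> bf; have [_ [M hM]] := bf.
exact: (slice_Cb2 x (pairing_continuous bf) (pairing_bound bf hM)).
Qed.

(** [hg_assoc] speaks of sets, through integrands not known to be measurable; the layer-cake formula
    carries it over to functions. *)
Lemma conv_assoc01 x y z f : Cb f -> (forall x, 0 <= f x <= 1) ->
  expect (conv x y) (fun u => expect (conv u z) f) =
  expect (conv y z) (fun v => expect (conv x v) f).
Proof.
move=> bf f01.
have l1 : layered (fun f => expect (conv x y) (fun u => expect (conv u z) f))
    (fun U => fine (\int[conv x y]_u conv u z U)%E).
  apply: (layered_expect (T := fun f u => expect (conv u z) f)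
    (a := fun U u => conv u z U)) => //.
  - exact: conv_finite.
  - by move=> g; exact: right_translate_Cb.
  - by move=> g h u /Cb_bmeas bg /Cb_bmeas bh; apply: expectD => //; exact: conv_finite.
  - by move=> c g u /Cb_bmeas bg; apply: expectZ => //; exact: conv_finite.
  - by move=> V g U u bg oV oU; apply: between_expect => //; exact: conv_finite.
  - by move=> U u oU; apply: conv_le1; exact: open_Bor.
have l2 : layered (fun f => expect (conv y z) (fun v => expect (conv x v) f))
    (fun U => fine (\int[conv y z]_v conv x v U)%E).
  apply: (layered_expect (T := fun f v => expect (conv x v) f)
    (a := fun U v => conv x v U)) => //.
  - exact: conv_finite.
  - by move=> g; exact: left_translate_Cb.
  - by move=> g h u /Cb_bmeas bg /Cb_bmeas bh; apply: expectD => //; exact: conv_finite.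
  - by move=> c g u /Cb_bmeas bg; apply: expectZ => //; exact: conv_finite.
  - by move=> V g U u bg oV oU; apply: between_expect => //; exact: conv_finite.
  - by move=> U u oU; apply: conv_le1; exact: open_Bor.
have := layered_eq l1 layered0 l2 layered0 _ bf f01.
rewrite !subr0; apply => U oU; rewrite !subr0.
by rewrite (hg_assoc hK)//; exact: open_Bor.
Qed.

(** Reduces to [conv_assoc01] by the affine change [g = (f + M) / (2 * M)], which commutes with
    means against probability measures. *)
Lemma conv_assoc x y z f : Cb f ->
  expect (conv x y) (fun u => expect (conv u z) f) =
  expect (conv y z) (fun v => expect (conv x v) f).
Proof.
move=> bf; have [_ [M0 hM0]] := bf.
have [M M0' hM] : exists2 M : R, 0 < M & forall x', `|f x'| <= M.
  exists (`|M0| + 1) => [|x']; first by rewrite ltr_wpDl.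
  by apply: le_trans (hM0 x') _; rewrite (le_trans (ler_norm _))// lerDl.
pose g x' := (2 * M)^-1 * (f x' + M).
have bg : Cb g by apply: CbZ; apply: CbD => //; exact: Cb_cst.
have g01 x' : 0 <= g x' <= 1.
  have := hM x'; rewrite ler_norml => /andP[h1 h2].
  have M2 : 0 < 2 * M by rewrite mulr_gt0.
  rewrite /g mulrC; apply/andP; split; last by rewrite ler_pdivrMr//; lra.
  by apply: divr_ge0; [lra|exact: ltW].
have fE : f = (fun x' => (2 * M) * g x' - M).
  by apply/funext => x'; rewrite /g mulVKf ?addrK// mulf_neq0// gt_eqF.
have E a b (h : K -> R) : Cb h ->
    expect (conv a b) (fun x' => (2 * M) * h x' - M) = (2 * M) * expect (conv a b) h - M.
  move=> /Cb_bmeas bh; have fc := conv_finite a b.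
  rewrite expectB//; [|exact: bmeasZ|exact: bmeas_cst].
  by rewrite expectZ// expect_cst (hg_prob hK) mulr1.
rewrite fE; under eq_fun do rewrite E//.
under [in RHS]eq_fun do rewrite E//.
by rewrite !E ?conv_assoc01//; [exact: left_translate_Cb|exact: right_translate_Cb].
Qed.

Lemma expect_conve y f : Cb f -> expect (conv e y) f = f y.
Proof.
move=> bf; rewrite /expect.
rewrite (@eq_measure_integral _ _ _ _ (\d_(y : Bor K))); last first.
  by move=> A mA _; have [] := hg_unit hK y mA.
rewrite integral_dirac ?diracT ?mul1e//.
by apply/measurable_EFinP; exact: (continuous_Bor bf.1).
Qed.

Lemma expect_convxe x f : Cb f -> expect (conv x e) f = f x.
Proof.
move=> bf; rewrite /expect.
rewrite (@eq_measure_integral _ _ _ _ (\d_(x : Bor K))); last first.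
  by move=> A mA _; have [] := hg_unit hK x mA.
rewrite integral_dirac ?diracT ?mul1e//.
by apply/measurable_EFinP; exact: (continuous_Bor bf.1).
Qed.

(** Were the mean 0, [- f] would attain its upper bound 0 in mean, and [expect_max_supp] would give
    [f z = 0]. *)
Lemma expect_gt0 x y f z : Cb f -> (forall u, 0 <= f u) ->
  msupport (conv x y) z -> 0 < f z -> 0 < expect (conv x y) f.
Proof.
move=> bf f0 Sz fz; rewrite lt_neqAle eq_sym expect_ge0// andbT.
apply/eqP => E.
suff : -1 * f z = 0 by move/eqP; rewrite mulN1r oppr_eq0 gt_eqF.
apply: (@expect_max_supp R K (conv x y) (fun u => -1 * f u) 0) => //.
- exact: (hg_prob hK).
- exact: CbZ.
- by move=> u; rewrite mulN1r oppr_le0.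
- rewrite expectZ ?E ?mulr0//; [exact: conv_finite|exact: Cb_bmeas].
Qed.

Lemma msupport_inv x y z : msupport (conv x y) z ->
  msupport (conv (inv y) (inv x)) (inv z).
Proof.
move=> Sz U oU Uz; rewrite -(hg_inv_conv hK); last exact: open_Bor.
apply: Sz => //; apply: open_comp => // u _; exact: (hg_inv_cont hK).
Qed.

(** A bump at [e] inside [U] has positive mean over [(x * y) * z^-], because [z] lies in [x * y] and
    [e] in [z * z^-]. By associativity the mean over [x * (y * z^-)] is positive, so that [U] is
    met. *)
Lemma msupport_translate x y z (U : set K) : msupport (conv x y) z ->
  open U -> U e ->
  exists2 v, msupport (conv y (inv z)) v & exists2 t, U t & msupport (conv x v) t.
Proof.
move=> Sz oU Ue; have [||f [ccf f01 fe fU]] :=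
    @urysohn_Cc R K lcK hdK [set e] U _ oU; first exact: compact_set1.
  by move=> _ ->.
have bf := Cc_Cb ccf; have f0 u : 0 <= f u by have /andP[] := f01 u.
have lhs : 0 < expect (conv x y) (fun u => expect (conv u (inv z)) f).
  apply: (expect_gt0 (z := z)) => //; first exact: right_translate_Cb.
    by move=> u; exact: expect_ge0.
  apply: (expect_gt0 (z := e)) => //; last by rewrite fe.
  exact/(hg_e_supp hK).
move: lhs; rewrite conv_assoc// => rhs.
apply: contrapT => nex; move: rhs.
rewrite (expect_supp0 hdK (conv_radon _ _) (conv_finite _ _)) ?ltxx//.
  exact: left_translate_Cb.
move=> v Sv; apply: (expect_supp0 hdK (conv_radon _ _) (conv_finite _ _)) => // t St.
apply: fU => Ut; apply: nex; exists v => //; by exists t.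
Qed.

(* Set associativity at the identity: both [z \in x * y] and [x \in z * y^-]
   say that [e] lies in [x * y * z^-]. *)
Lemma msupport_shift x y z : msupport (conv x y) z -> msupport (conv z (inv y)) x.
Proof.
(* From [e] in [x * v] follows [v = x^-], so [x^-] lies in [y * z^-], and the involution turns this
   into the claim. *)
move=> Sz; suff [v Sv Se] : exists2 v, msupport (conv y (inv z)) v & msupport (conv x v) e.
  move/(hg_e_supp hK) : Se => ve; move: Sv; rewrite ve => /msupport_inv.
  by rewrite !(hg_invK hK).
apply: contrapT => nex.
have /compact_near_coveringP cS : compact (msupport (conv y (inv z))).
  exact: (hg_cpt_supp hK).
(* If [e] avoids every [x * v], regularity separates it from each support and upper semicontinuity
   keeps this for nearby [v]; compactness then gives one neighbourhood of [e], against
   [msupport_translate]. *)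
have : nbhs e (fun t => msupport (conv y (inv z)) `<=` (fun v => ~ msupport (conv x v) t)).
  apply: cS => v Sv.
  have clS : closed (msupport (conv x v)).
    by apply: compact_closed => //; exact: (hg_cpt_supp hK).
  have ne : ~ msupport (conv x v) e by move=> h; apply: nex; exists v.
  have regK := @completely_regular_regular R K
    (locally_compact_completely_regular (R := R) lcK hdK).
  have [U [V [oU oV Ue SV UV]]] := (regular_openP e).1 (regK e) _ clS ne.
  have := hg_michael2 hK oV; rewrite openE => /(_ (x, v) SV) -[[/= P Q] [Px Qv] PQ].
  exists (Q, U) => /=; first by split => //; exact: open_nbhs_nbhs.
  move=> [v' t] /= [Qv' Ut] St.
  have : (U `&` V) t.
    by split => //; apply: (PQ (x, v')) => //=; split => //=; exact: nbhs_singleton.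
  by rewrite UV.
rewrite nbhsE => -[U [oU Ue] US].
have [v Sv [t Ut St]] := msupport_translate Sz oU Ue.
exact: (US t Ut v Sv).
Qed.

Lemma setconv_compact (C D : set K) : compact C -> compact D ->
  exists2 Q : set K, compact Q & setconv conv C D `<=` Q.
Proof.
move=> cC cD; have /compact_near_coveringP cX := compact_setX cC cD.
(* The filter of all sufficiently large [Q]: near covering then merges the local compact bounds on
   supports into a single one. *)
pose F := filter_from (@compact K) (fun Q => [set Q' : set K | Q `<=` Q']).
have FF : Filter F.
  apply: filter_from_filter; first by exists set0; exact: compact0.
  move=> Q1 Q2 cQ1 cQ2; exists (Q1 `|` Q2); first exact: compactU.
  by move=> Q' QQ'; split; apply: subset_trans QQ'; [exact: subsetUl|exact: subsetUr].
have [p _|Q cQ QX] := cX _ F (fun Q p => msupport (conv p.1 p.2) `<=` Q) FF.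
  have [|W cW SW] := @compact_subset_interior K lcK (msupport (conv p.1 p.2)).
    exact: (hg_cpt_supp hK).
  exists ([set q : K * K | msupport (conv q.1 q.2) `<=` W°], [set Q' : set K | W `<=` Q']).
    split; last by exists W.
    apply: open_nbhs_nbhs; split => //.
    by apply: (hg_michael2 hK); exact: open_interior.
  move=> [q Q'] /= [Sq WQ']; apply: subset_trans WQ'.
  by apply: subset_trans Sq _; exact: interior_subset.
exists Q => // z [a [b [Ca Db Sz]]].
exact: (QX Q (@subset_refl _ Q) (a, b) (conj Ca Db)).
Qed.

(** Take [C] carrying [P] up to [eps] and [D] supporting [f]. For [y] in [C], a point [z] of [D] in
    [x * y] forces [x] into [D * C^-], which lies in a compact set. *)
Lemma expect_translate_vanish (P : pmeas R K) (f : K -> R) (eps : R) :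
  finite_meas P -> radon P -> Cc f -> (forall x, 0 <= f x <= 1) -> 0 < eps ->
  exists2 Q : set K, compact Q &
    forall x, ~ Q x -> expect P (fun y => expect (conv x y) f) <= eps.
Proof.
move=> fP rP ccf f01 e0; have bf := Cc_Cb ccf; have [_ [D [cD fD]]] := ccf.
have [C cC hC] := radon_tight hdK rP fP e0.
have cC' : compact (inv @` C).
  by apply: continuous_compact => //; apply: continuous_subspaceT; exact: (hg_inv_cont hK).
have [Q cQ QC] := setconv_compact cD cC'.
exists Q => // x nQ; apply: le_trans hC.
have mC : measurable (~` C : set (Bor K)) by apply: measurableC; exact: compact_Bor.
rewrite -(expect_indic P mC); apply: expect_le => //.
- by apply: Cb_bmeas; exact: left_translate_Cb.
- exact: bmeas_indic.
- move=> y; rewrite indicE in_setC; have [/set_mem Cy|_] := boolP (y \in C); last first.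
    by have /andP[] := expect_conv_itv x y bf f01.
  rewrite (expect_supp0 hdK (conv_radon _ _) (conv_finite _ _))// => z Sz.
  apply: fD => Dz; apply: nQ; apply: QC; exists z, (inv y); split => //.
  exact: msupport_shift.
Qed.

(** * Harmonic functions and invariant measures *)

Section Invariant.
Variable sigma : pmeas R K.
Hypothesis sigma_prob : sigma setT = 1%E.
Hypothesis sigma_radon : radon sigma.
Hypothesis sigma_nd : hg_nondegenerate conv sigma.

Let fsigma : finite_meas sigma.
Proof. by rewrite /finite_meas sigma_prob ltry. Qed.

(** Two uses of [expect_max_supp], for [sigma] and then for [conv a x], spread the value [M] from
    [a] to [a * x] for [x] in the support of [sigma]. Starting at [e] this reaches all powers of the
    support, which are dense, and the set where [g = M] is closed. *)
Lemma harmonic_max (g : K -> R) (M : R) : Cb g -> (forall x, g x <= M) ->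
  (forall a, g a = expect sigma (fun x => expect (conv a x) g)) ->
  g e = M -> forall x, g x = M.
Proof.
move=> bg gM harm ge.
have step a x y : g a = M -> msupport sigma x -> msupport (conv a x) y -> g y = M.
  move=> ga Sx; apply: (expect_max_supp _ bg gM); first exact: (hg_prob hK).
  apply: (expect_max_supp (M := M) sigma_prob (left_translate_Cb a bg)) => //.
    move=> t; have := expect_le (conv_finite a t) (Cb_bmeas bg) (bmeas_cst M) gM.
    by rewrite expect_cst (hg_prob hK) mulr1.
  by rewrite -harm.
have pow n : setpow conv (msupport sigma) n `<=` [set x | g x = M].
  elim: n => [|n IH] x /=; last by move=> [a [b [/IH ga Sb Sx]]]; exact: step Sx.
  (* Index 0 of [setpow] is the support itself, reached from [e] since [x] lies in [e * x]. *)
  move=> Sx; apply: (step e x) => // U oU Ux.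
  have [-> _] := hg_unit hK x (open_Bor oU).
  by rewrite diracE mem_set.
have clM : closed [set x | g x = M].
  rewrite (_ : [set x | g x = M] = g @^-1` [set M])//.
  by apply: closed_comp; [move=> x _; exact: bg.1|exact: closed_eq].
move=> x; have : [set: K] x by [].
rewrite -sigma_nd => /(closureS (B := [set x | g x = M])).
rewrite -(closure_id _).1//; apply.
by move=> y [n _ /pow].
Qed.

Section pair.
Variables P N : pmeas R K.
Hypotheses (fP : finite_meas P) (fN : finite_meas N).
Hypotheses (rP : radon P) (rN : radon N).
Hypothesis inv_PN : forall U : set K, open U ->
  fine (\int[P]_y \int[sigma]_x conv x y U)%E - fine (\int[N]_y \int[sigma]_x conv x y U)%E
  = fine (P U) - fine (N U).

(** The function [h] of the opening sketch. *)
Definition orbit_fun (f : K -> R) x :=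
  expect P (fun y => expect (conv x y) f) - expect N (fun y => expect (conv x y) f).

Lemma expect_orbit_Cb (Q : pmeas R K) f : finite_meas Q -> radon Q -> Cb f ->
  Cb (fun x => expect Q (fun y => expect (conv x y) f)).
Proof.
move=> fQ rQ bf; have [_ [M hM]] := bf.
exact: (expect_slice_Cb2 lcK hdK fQ rQ (pairing_continuous bf) (pairing_bound bf hM)).
Qed.

Lemma expect_orbit_swap (Q m : pmeas R K) f :
  finite_meas Q -> radon Q -> finite_meas m -> radon m -> Cb f ->
  expect Q (fun y => expect m (fun x => expect (conv x y) f)) =
  expect m (fun x => expect Q (fun y => expect (conv x y) f)).
Proof.
move=> fQ rQ fm rm bf; have [_ [M hM]] := bf.
by rewrite (expect_fubini lcK hdK fm rm fQ rQ (pairing_continuous bf) (pairing_bound bf hM)).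
Qed.

Lemma orbit_Cb f : Cb f -> Cb (orbit_fun f).
Proof. by move=> bf; apply: CbB; exact: expect_orbit_Cb. Qed.

(** Associativity under the integral in [y], followed by an exchange of integrals. *)
Lemma orbit_translate f a x : Cb f ->
  orbit_fun (fun u => expect (conv a u) f) x = expect (conv a x) (orbit_fun f).
Proof.
move=> bf; rewrite /orbit_fun expectB; first last.
- by apply: Cb_bmeas; exact: expect_orbit_Cb.
- by apply: Cb_bmeas; exact: expect_orbit_Cb.
- exact: conv_finite.
have E (Q : pmeas R K) : finite_meas Q -> radon Q ->
    expect Q (fun y => expect (conv x y) (fun u => expect (conv a u) f)) =
    expect (conv a x) (fun x0 => expect Q (fun y => expect (conv x0 y) f)).
  move=> fQ rQ; rewrite -expect_orbit_swap//; [|exact: conv_finite|exact: conv_radon].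
  by congr expect; apply/funext => y; rewrite conv_assoc.
by rewrite !E.
Qed.

Lemma layered_sigma (Q : pmeas R K) : finite_meas Q -> radon Q ->
  layered (fun f => expect Q (fun y => expect sigma (fun x => expect (conv x y) f)))
    (fun U => fine (\int[Q]_y \int[sigma]_x conv x y U)%E).
Proof.
move=> fQ rQ.
apply: (layered_expect (T := fun f y => expect sigma (fun x => expect (conv x y) f))
  (a := fun U y => (\int[sigma]_x conv x y U)%E)) => //.
- move=> f bf; have [_ [M hM]] := bf.
  exact: (expect_slice_Cb lcK hdK fsigma sigma_radon
    (pairing_continuous bf) (pairing_bound bf hM)).
- move=> f g y bf bg.
  rewrite -expectD//; try by apply: Cb_bmeas; exact: right_translate_Cb.
  congr expect; apply/funext => x; apply: expectD; [exact: conv_finite|exact: Cb_bmeas..].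
- move=> c f y bf.
  rewrite -expectZ//; last by apply: Cb_bmeas; exact: right_translate_Cb.
  congr expect; apply/funext => x; apply: expectZ; [exact: conv_finite|exact: Cb_bmeas].
- move=> V f U y bf oV oU vfu.
  rewrite expectK//; last by apply: Cb_bmeas; exact: right_translate_Cb.
  have h x := between_expect (conv_finite x y) bf oV oU vfu.
  apply/andP; split; apply: le_lower_integral => x //; try by have /andP[] := h x.
  by have /andP[+ _] := h x; apply: le_trans.
- move=> U y oU; rewrite integral_ge0//=; apply: (@le_trans _ _ (\int[sigma]_x cst 1 x)%E).
    by apply: le_lower_integral => x //; have /andP[] := conv_le1 x y (open_Bor oU).
  by rewrite integral_cst// mul1e sigma_prob.
Qed.

(** After exchanging the integrals, this is [inv_PN] carried from open sets to functions by
    [layered_eq]. *)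
Lemma orbit_invariant f : Cb f -> (forall x, 0 <= f x <= 1) ->
  expect P f - expect N f = expect sigma (orbit_fun f).
Proof.
move=> bf f01; rewrite /orbit_fun expectB//; try by apply: Cb_bmeas; exact: expect_orbit_Cb.
rewrite -!expect_orbit_swap//.
apply: (layered_eq (layered_measure fP) (layered_measure fN)
  (layered_sigma fP rP) (layered_sigma fN rN)) => // U oU.
by rewrite inv_PN.
Qed.

Lemma orbit_harmonic f a : Cb f -> (forall x, 0 <= f x <= 1) ->
  orbit_fun f a = expect sigma (fun x => expect (conv a x) (orbit_fun f)).
Proof.
move=> bf f01; rewrite {1}/orbit_fun orbit_invariant.
- by congr expect; apply/funext => x; exact: orbit_translate.
- exact: left_translate_Cb.
- by move=> x; exact: expect_conv_itv.
Qed.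

Lemma orbit_max_const f a : Cb f -> (forall x, 0 <= f x <= 1) ->
  (forall x, orbit_fun f x <= orbit_fun f a) ->
  forall x, orbit_fun f x = orbit_fun f a.
Proof.
move=> bf f01 fa; have bo := orbit_Cb bf.
pose fa' u := expect (conv a u) f.
have ba : Cb fa' by exact: left_translate_Cb.
have h1 : forall x, orbit_fun fa' x = orbit_fun f a.
  apply: harmonic_max => //.
  - exact: orbit_Cb.
  - move=> x; rewrite orbit_translate//.
    have := expect_le (conv_finite a x) (Cb_bmeas bo) (bmeas_cst (orbit_fun f a)) fa.
    by rewrite expect_cst (hg_prob hK) mulr1.
  - by move=> b; apply: orbit_harmonic => // x; exact: expect_conv_itv.
  - by rewrite orbit_translate// expect_convxe.
apply: harmonic_max => //; first by move=> b; exact: orbit_harmonic.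
(* By [h1] at [inv a], the mean of [orbit_fun f] over [a * a^-] is its maximum, hence so is its
   value at [e], a point of that support. *)
apply: (expect_max_supp (hg_prob hK a (inv a)) bo fa); last exact/(hg_e_supp hK).
by rewrite -orbit_translate// h1.
Qed.

Hypothesis noncpt : ~ compact [set: K].

Lemma orbit_le0 f : Cc f -> (forall x, 0 <= f x <= 1) -> forall x, orbit_fun f x <= 0.
Proof.
move=> ccf f01 x0; rewrite leNgt; apply/negP => t0.
have bf := Cc_Cb ccf; have bo := orbit_Cb bf.
set t := orbit_fun f x0 in t0.
have t2 : 0 < t / 2 by rewrite divr_gt0.
have [Q cQ hQ] := expect_translate_vanish fP rP ccf f01 t2.
pose A := [set x | t <= orbit_fun f x].
have AQ : A `<=` Q.
  move=> x Ax; apply: contrapT => /hQ h; move: Ax; rewrite /A /= leNgt => /negP; apply.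
  (* Only the [P] part has to be small off [Q], because the [N] part is subtracted; [t / 2] makes
     the bound strictly below [t]. *)
  have N0 : 0 <= expect N (fun y => expect (conv x y) f).
    by apply: expect_ge0 => y; have /andP[] := expect_conv_itv x y bf f01.
  rewrite /orbit_fun; apply: (@le_lt_trans _ _ (t / 2)); last first.
    by rewrite ltr_pdivrMr// ltr_pMr// ltr1n.
  by rewrite lerBlDr (le_trans h)// lerDl.
have clA : closed A.
  apply: (@closed_comp _ _ (orbit_fun f) [set s | t <= s]); last exact: closed_ge.
  by move=> x _; exact: bo.1.
have cA : compact A by exact: subclosed_compact cQ AQ.
have [||a] := @compact_EVT_max K R (orbit_fun f) A _ cA.
- by exists x0; rewrite /A /=.
- by apply: continuous_subspaceT; exact: bo.1.
rewrite inE => Aa amax.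
have gmax x : orbit_fun f x <= orbit_fun f a.
  have [/mem_set/amax//|nA] := pselect (A x).
  by apply: le_trans Aa; apply: ltW; rewrite ltNge; apply/negP.
have cst := orbit_max_const bf f01 gmax.
(* A constant [orbit_fun f] makes the compact set [A] the whole space. *)
apply: noncpt; apply: subclosed_compact cA _; first exact: closedT.
by move=> x _; rewrite /A /= cst.
Qed.

End pair.

(** The hypothesis is symmetric under exchanging [P] and [N], so [orbit_le0] applies both ways; at
    [e] the orbit function is the integral of [f] against [P - N]. *)
Lemma invariant_pair_eq (P N : pmeas R K) : ~ compact [set: K] ->
  finite_meas P -> finite_meas N -> radon P -> radon N ->
  (forall U : set K, open U ->
    fine (\int[P]_y \int[sigma]_x conv x y U)%E -
    fine (\int[N]_y \int[sigma]_x conv x y U)%E = fine (P U) - fine (N U)) ->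
  forall A : set (Bor K), measurable A -> P A = N A.
Proof.
move=> noncpt fP fN rP rN PN; apply: (radon_eq lcK hdK) => // f ccf f01.
have bf := Cc_Cb ccf.
have NP (U : set K) : open U ->
    fine (\int[N]_y \int[sigma]_x conv x y U)%E -
    fine (\int[P]_y \int[sigma]_x conv x y U)%E = fine (N U) - fine (P U).
  by move=> /PN h; rewrite -[LHS]opprB h opprB.
have h1 := orbit_le0 fP fN rP rN PN noncpt ccf f01 e.
have h2 := orbit_le0 fN fP rN rP NP noncpt ccf f01 e.
move: h1 h2; rewrite /orbit_fun.
have -> : (fun y => expect (conv e y) f) = f.
  by apply/funext => y; rewrite expect_conve.
by rewrite !subr_le0 => h1 h2; apply/eqP; rewrite eq_le h1 h2.
Qed.

End Invariant.
End Hypergroup.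

Theorem theorem4p16 (R : realType) (K : ptopologicalType)
    (conv : K -> K -> pmeas R K) (e : K) (inv : K -> K)
    (hK : is_hypergroup conv e inv)
    (haar : has_left_Haar conv)
    (noncpt : ~ compact [set: K])
    (sigma : pmeas R K)
    (sigma_prob : sigma setT = 1%E)
    (sigma_radon : radon sigma)
    (sigma_nd : hg_nondegenerate conv sigma) :
  forall mu : cmeasure R K, H_sigma conv sigma mu <-> zero_cmeasure mu.
Proof.
move=> mu; have [f1 f2 f3 f4] := cm_finite mu; have [r1 r2 r3 r4] := cm_radon mu.
split=> [hmu A mA|zmu A mA].
  (* As [sigma] is positive, the real and imaginary parts are fixed separately. *)
  have pair_eq := invariant_pair_eq hK sigma_prob sigma_radon sigma_nd noncpt.
  rewrite /cval (pair_eq _ _ f1 f2 r1 r2) ?(pair_eq _ _ f3 f4 r3 r4) ?subrr// => U oU.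
  - by have [] := hmu U (open_Bor oU).
  - by have [] := hmu U (open_Bor oU).
(* Conversely, a zero measure has equal positive and negative components, so their integrals agree
   for any integrand, measurable or not. *)
have z1 B : measurable B -> mu_rp mu B = mu_rn mu B.
  move=> mB; have [/eqP + _] := zmu B mB; rewrite subr_eq0 => /eqP h.
  by rewrite -(fineK (finite_fin f1 mB)) h fineK//; exact: finite_fin.
have z2 B : measurable B -> mu_ip mu B = mu_in mu B.
  move=> mB; have [_ /eqP +] := zmu B mB; rewrite subr_eq0 => /eqP h.
  by rewrite -(fineK (finite_fin f3 mB)) h fineK//; exact: finite_fin.
rewrite zmu// /cconv; congr pair; apply/eqP; rewrite subr_eq0; apply/eqP;
  congr fine; apply: eq_measure_integral => B mB _; [exact: z1|exact: z2].
Qed.
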